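(* Let $\beta\in\mathbb{C}$ with $|\beta|>1$ be an algebraic integer of degree $d$ with minimal polynomial $f(X)=X^d-a_{d-1}X^{d-1}-\cdots-a_1X-a_0\in\mathbb{Z}[X]$. Let $\mathcal{A}$ be a finite set of contiguous integers containing $0$ and $1$. If addition in $\mathrm{Fin}_{\mathcal{A}}(\beta)$ is computable in parallel, then $\#\mathcal{A}\geqslant |f(1)|$. If moreover $\beta$ is a real number with $\beta>1$, then $\#\mathcal{A}\geqslant |f(1)|+2$.
   Context: For a complex number $\beta$ with $|\beta|>1$ and a finite set $\mathcal{A}\subset\mathbb{C}$ containing $0$, let $\mathrm{Fin}_{\mathcal{A}}(\beta)=\{\sum_{j\in I}x_j\beta^j : I\subset\mathbb{Z}\text{ finite},\ x_j\in\mathcal{A}\}$. A bi-infinite sequence $(u_j)_{j\in\mathbb{Z}}$ with finitely many nonzero entries represents the number $\sum_j u_j\beta^j$. For finite alphabets $\mathcal{A},\mathcal{B}$, a map $\varphi:\mathcal{A}^{\mathbb{Z}}\to\mathcal{B}^{\mathbb{Z}}$ is $p$-local if there are integers $r,t\geqslant 0$ with $p=r+t+1$ and a map $\Phi:\mathcal{A}^p\to\mathcal{B}$ such that for every $u=(u_j)$ and $v=\varphi(u)$ one has $v_j=\Phi(u_{j+t}\cdots u_j\cdots u_{j-r})$ for all $j\in\mathbb{Z}$. A digit set conversion in base $\beta$ from $\mathcal{A}$ to $\mathcal{B}$ (both containing $0$) is a map $\varphi:\mathcal{A}^{\mathbb{Z}}\to\mathcal{B}^{\mathbb{Z}}$ such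 that whenever $u$ has finitely many nonzero entries, $v=\varphi(u)$ has finitely many nonzero entries and $\sum_j v_j\beta^j=\sum_j u_j\beta^j$; it is computable in parallel if it is $p$-local for some $p\in\mathbb{N}$. Addition in $\mathrm{Fin}_{\mathcal{A}}(\beta)$ is computable in parallel if there exists a digit set conversion in base $\beta$ from $\mathcal{A}+\mathcal{A}=\{x+y: x,y\in\mathcal{A}\}$ to $\mathcal{A}$ that is computable in parallel. *)

(* Defs.v *)
From mathcomp Require Import all_boot all_order all_algebra.
From mathcomp Require Import finmap.
From mathcomp Require Import classical_sets cardinality fsbigop reals.
From mathcomp Require Import complex.

Set Implicit Arguments.
Unset Strict Implicit.
Unset Printing Implicit Defensive.

Import Order.TTheory GRing.Theory Num.Theory.
Local Open Scope fset_scope.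
Local Open Scope classical_set_scope.
Local Open Scope ring_scope.

(* An alphabet is a finite set [A : {fset C}], coerced to the type of its
   letters; [int -> A] is then the space of bi-infinite sequences over [A].   *)

Definition finitely_supported (C : numClosedFieldType) (A : {fset C})
    (u : int -> A) : Prop :=
  finite_set [set j : int | val (u j) != 0].

(* This is a junk value unless [u] is finitely supported (for [beta != 0]).   *)
Definition represented_number (C : numClosedFieldType) (beta : C)
    (A : {fset C}) (u : int -> A) : C :=
  \sum_(j \in [set: int]) val (u j) * beta ^ j.

(* Windows are read from left to right with decreasing indices:
   [u_(j+t) ... u_j ... u_(j-r)].                                             *)
Definition p_local (C : numClosedFieldType) (A B : {fset C}) (p : nat)
    (phi : (int -> A) -> (int -> B)) : Prop :=
  exists (r t : nat) (Phi : p.-tuple A -> B),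
    p = (r + t + 1)%N /\
    forall (u : int -> A) (j : int),
      phi u j = Phi [tuple u (j + t%:Z - (i : nat)%:Z) | i < p].

Definition digit_set_conversion (C : numClosedFieldType) (beta : C)
    (A B : {fset C}) (phi : (int -> A) -> (int -> B)) : Prop :=
  [/\ 0 \in A, 0 \in B &
      forall u : int -> A, finitely_supported u ->
        finitely_supported (phi u) /\
        represented_number beta (phi u) = represented_number beta u].

Definition computable_in_parallel (C : numClosedFieldType) (A B : {fset C})
    (phi : (int -> A) -> (int -> B)) : Prop :=
  exists p : nat, p_local p phi.

Definition alphabet_sum (C : numClosedFieldType) (A B : {fset C}) : {fset C} :=
  [fset x + y | x in A, y in B].

Definition parallel_addition (C : numClosedFieldType) (beta : C)
    (A : {fset C}) : Prop :=
  exists phi : (int -> alphabet_sum A A) -> (int -> A),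
    digit_set_conversion beta phi /\ computable_in_parallel phi.

Definition contiguous_integers (C : numClosedFieldType) (A : {fset C}) : Prop :=
  exists m n : int, forall z : C,
    z \in A <-> exists2 k : int, m <= k <= n & z = k%:~R.

Definition is_minimal_polynomial (C : numClosedFieldType) (p : {poly rat})
    (z : C) : Prop :=
  [/\ p \is monic, root (map_poly ratr p) z &
      forall q : {poly rat}, q \is monic -> root (map_poly ratr q) z ->
        (size p <= size q)%N].

(* Main.v *)
(* Let [g x] be the letter produced by the conversion on the constant sequence
   [x].  Lengthening a finite run of [x] by one letter inserts one letter [g x]
   in the image and shifts what lies above it; comparing values gives
   [x = g x] modulo [beta - 1] in [Z[beta, 1/beta]], that is, modulo [f(1)].
   Taking [x = M + 1] with [m = min A] and [M = max A], the nonzero difference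
   [M + 1 - g (M + 1)] is a multiple of [f(1)] and is at most [#A].
   If [beta > 1], comparing a long run of [x] with the same sequence where the
   low half of the run is replaced by [y] shows that [g x = m] forces [x <= y]
   and [g x = M] forces [y <= x].  With [y = 0] and [y = 2M] this gives
   [m < g M < M], so [f(1)] divides a positive integer at most [#A - 2].  *)
Require Import Defs.
From mathcomp Require Import all_boot all_order all_algebra.
From mathcomp Require Import finmap.
From mathcomp Require Import classical_sets cardinality fsbigop reals.
From mathcomp Require Import complex.
From mathcomp Require Import zify ring.

Set Implicit Arguments.
Unset Strict Implicit.
Unset Printing Implicit Defensive.

Import Order.TTheory GRing.Theory Num.Theory.
Local Open Scope ring_scope.

(** Division by the monic [f] stays in Z[X]. A nonzero remainder, made monic over the rationals,
    would vanish at [beta] with degree below that of [f]. *)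
Lemma monic_min_dvd (F : numFieldType) (beta : F) (f q : {poly int}) :
  f \is monic ->
  (forall p : {poly rat}, p \is monic -> root (map_poly ratr p) beta ->
     (size f <= size p)%N) ->
  root (map_poly intr f) beta -> root (map_poly intr q) beta ->
  exists s, q = s * f.
Proof.
move=> f_monic f_min rf rq; have f0 := monic_neq0 f_monic.
have q_eq := Pdiv.RingMonic.rdivp_eq f_monic q.
set s := Pdiv.Ring.rdivp q f in q_eq; set e := Pdiv.Ring.rmodp q f in q_eq.
have lt_ef : (size e < size f)%N by apply: Pdiv.Ring.ltn_rmodpN0.
exists s; suff /eqP e0 : e == 0 by rewrite {1}q_eq e0 addr0.
apply/negPn/negP => e_neq0.
pose eQ : {poly rat} := map_poly intr e.
have size_eQ : size eQ = size e by apply: size_map_inj_poly => //; apply: intr_inj.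
have lc0 : lead_coef eQ != 0 by rewrite lead_coef_eq0 -size_poly_eq0 size_eQ size_poly_eq0.
have re : root (map_poly ratr eQ) beta.
  have -> : map_poly ratr eQ = map_poly (intr : int -> F) e.
    by rewrite -map_poly_comp; apply: eq_map_poly => k /=; rewrite ratr_int.
  move: rq; rewrite q_eq rmorphD rmorphM /= /root hornerD hornerM.
  by rewrite (rootP rf) mulr0 add0r.
have := f_min ((lead_coef eQ)^-1 *: eQ).
rewrite monicE lead_coefZ mulVf // eqxx map_polyZ /= rootZ ?fmorph_eq0 ?invr_eq0 //.
by rewrite size_scale ?invr_eq0 // size_eQ leqNgt lt_ef => /(_ isT re).
Qed.

(** * Values of finite segments of a sequence *)

Definition segment (C : numClosedFieldType) (beta : C) (A : {fset C})
    (u : int -> A) (lo : int) (n : nat) : C :=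
  \sum_(i < n) val (u (lo + i%:Z)) * beta ^ (lo + i%:Z).

Lemma segmentD (C : numClosedFieldType) (beta : C) (A : {fset C})
    (u : int -> A) (lo : int) (m n : nat) :
  segment beta u lo (m + n) = segment beta u lo m + segment beta u (lo + m%:Z) n.
Proof.
rewrite /segment big_split_ord /=; congr (_ + _).
by apply: eq_bigr => i _; rewrite PoszD addrA.
Qed.

Lemma segment1 (C : numClosedFieldType) (beta : C) (A : {fset C})
    (u : int -> A) (lo : int) :
  segment beta u lo 1 = val (u lo) * beta ^ lo.
Proof. by rewrite /segment big_ord1 /= addr0. Qed.

Lemma segment_shift (C : numClosedFieldType) (beta : C) (A : {fset C})
    (u u' : int -> A) (lo k : int) (n : nat) : beta != 0 ->
  (forall i : nat, (i < n)%N -> u' (lo + k + i%:Z) = u (lo + i%:Z)) ->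
  segment beta u' (lo + k) n = beta ^ k * segment beta u lo n.
Proof.
move=> b0 eq_u; rewrite /segment mulr_sumr; apply: eq_bigr => i _.
rewrite eq_u // mulrCA -expfzDr //; congr (_ * _ ^ _); lia.
Qed.

Lemma represented_number_segment (C : numClosedFieldType) (beta : C)
    (A : {fset C}) (u : int -> A) (lo : int) (n : nat) :
  (forall j : int, ~~ (lo <= j < lo + n%:Z) -> val (u j) = 0) ->
  finitely_supported u /\ represented_number beta u = segment beta u lo n.
Proof.
move=> u0; pose r : seq int := [seq lo + i%:Z | i <- iota 0 n].
have mem_r j : (j \in r) = (lo <= j < lo + n%:Z).
  apply/mapP/idP => [[k]|lo_j]; first by rewrite mem_iota => ? ->; lia.
  by exists `|j - lo|%N; rewrite ?mem_iota; lia.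
have uniq_r : uniq r by rewrite map_inj_uniq ?iota_uniq // => i k /addrI [].
split.
  apply: (@sub_finite_set _ _ [set` r]%classic); last exact: finite_seq.
  move=> j /= uj.
  by rewrite mem_r; apply: contraNT uj => /u0 ->.
rewrite /represented_number.
have <- : \sum_(j <- r) val (u j) * beta ^ j = \sum_(j \in [set: int]%classic) val (u j) * beta ^ j.
  rewrite (bigfs _ (P := xpredT) uniq_r).
    by apply: eq_fsbigl; apply/seteqP; split.
  by move=> j _; rewrite mem_r => /u0 ->; rewrite mul0r.
by rewrite big_map -[X in iota _ X]subn0 -/(index_iota 0 n) big_mkord.
Qed.

(** Locality freed from the window function: allowing two positions [j] and [j'] also encodes
    commutation with shifts. *)
Definition sliding_block (X Y : Type) (r t : nat)
    (phi : (int -> X) -> int -> Y) : Prop :=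
  forall u u' j j',
    (forall i : int, - r%:Z <= i <= t%:Z -> u (j + i) = u' (j' + i)) ->
    phi u j = phi u' j'.

Lemma p_local_sliding_block (C : numClosedFieldType) (A B : {fset C}) (p : nat)
    (phi : (int -> A) -> (int -> B)) :
  p_local p phi -> exists r t, sliding_block r t phi.
Proof.
case=> r [t [Phi [p_eq phiE]]]; exists r, t => u u' j j' eq_u.
rewrite !phiE; congr (Phi _); apply: eq_from_tnth => i; rewrite !tnth_mktuple.
have := eq_u (t%:Z - i%:Z); rewrite !addrA; apply.
have := ltn_ord i; lia.
Qed.

(** * Local conversions on finitely supported and constant sequences *)

Section Conversion.
Context (C : numClosedFieldType) (beta : C) (B A : {fset C}) (r t : nat).
Context (phi : (int -> B) -> (int -> A)).
Context (phi_dsc : digit_set_conversion beta phi).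
Context (phi_loc : sliding_block r t phi).

(** The zero sequence has a constant image, which must be finitely supported; hence a window of
    zeros can only produce the digit 0. *)
Lemma image_zero (u : int -> B) (j : int) :
  (forall i : int, - r%:Z <= i <= t%:Z -> val (u (j + i)) = 0) ->
  val (phi u j) = 0.
Proof.
move=> u0; case: phi_dsc => B0 A0 phiV; pose z : int -> B := fun=> [` B0]%fset.
have -> : phi u j = phi z 0.
  by apply: phi_loc => i /u0 ui; apply: val_inj; rewrite ui.
have [|fin_phi _] := phiV z.
  by apply: (represented_number_segment beta (lo := 0) (n := 0) _).1.
apply/eqP/negPn/negP => phi0.
have : finite_set [set: int]%classic.
  apply: sub_finite_set fin_phi => k _ /=.
  by rewrite (phi_loc (u' := z) (j' := 0)).
case/finite_fsetP => X eqX.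
pose s := [seq i%:Z | i <- iota 0 (size X).+1].
have : (size s <= size X)%N.
  apply: uniq_leq_size; first by rewrite map_inj_uniq ?iota_uniq // => ? ? [].
  by move=> k _; have : [set: int]%classic k by []; rewrite eqX.
by rewrite size_map size_iota ltnn.
Qed.

(** A window reaches [r] positions down and [t] up, so the image of a sequence living on [0, n)
    lives on [-t, n + r). *)
Lemma segment_image (u : int -> B) (n : nat) :
  (forall j : int, ~~ (0 <= j < n%:Z) -> val (u j) = 0) ->
  segment beta (phi u) (- t%:Z) (t + r + n) = segment beta u 0 n.
Proof.
move=> u0; case: phi_dsc => _ _ phiV.
have [fin_u <-] := represented_number_segment beta (lo := 0) u0.
have [_ <-] := phiV _ fin_u.
have [] := represented_number_segment beta (u := phi u) (lo := - t%:Z)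
  (n := (t + r + n)) _ => // j out_j.
by apply: image_zero => i i_rt; apply: u0; lia.
Qed.

(* Compares the images of the runs of [x] of lengths [r + t] and [r + t + 1]. *)
Lemma constant_image_eq (x : B) : beta != 0 ->
  exists v : int -> A,
    val x * beta ^+ (r + t) =
      val (phi (fun=> x) 0) * beta ^+ r + (beta - 1) * segment beta v r%:Z (r + t).
Proof.
move=> b0; case: (phi_dsc) => B0 _ _; pose z := [` B0]%fset; set n := (r + t)%N.
pose run k : int -> B := fun j => if 0 <= j < k%:Z then x else z.
have run0 k j : ~~ (0 <= j < k%:Z) -> val (run k j) = 0.
  by rewrite /run => /negPf ->.
have run1 k j : 0 <= j < k%:Z -> run k j = x by rewrite /run => ->.
exists (phi (run n)).
have := segment_image (@run0 (n + 1)%N).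
(* The image of the longer run is cut into [-t, r), the single position r, and n positions from r +
   1 on. *)
have -> : (t + r + (n + 1) = t + r + 1 + n)%N by lia.
rewrite (segmentD _ _ _ (t + r + 1) n) (segmentD _ _ _ (t + r) 1).
rewrite (segmentD _ _ 0 n 1).
rewrite -addrA.
have -> : - t%:Z + (t + r + 1)%:Z = r%:Z + 1 :> int by lia.
have -> : - t%:Z + (t + r)%:Z = r%:Z :> int by lia.
(* From position r on, windows no longer see the lower end of the run, so the longer run looks like
   the shorter one shifted by 1. *)
rewrite (segment_shift (u := phi (run n))) //; last first.
  move=> i lt_in; apply: phi_loc => j j_rt; rewrite /run.
  by congr (if _ then _ else _); lia.
have := segment_image (@run0 n); rewrite (segmentD _ _ _ (t + r) n).
have -> : - t%:Z + (t + r)%:Z = r%:Z :> int by lia.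
(* Below position r, windows stay below n = r + t, where both runs agree. *)
have -> : segment beta (phi (run (n + 1)%N)) (- t%:Z) (t + r) =
          segment beta (phi (run n)) (- t%:Z) (t + r).
  apply: eq_bigr => i _; congr (val _ * _); apply: phi_loc => j j_rt.
  have lt_i := ltn_ord i; rewrite /run.
  by congr (if _ then _ else _); lia.
have -> : segment beta (run (n + 1)%N) 0 n = segment beta (run n) 0 n.
  apply: eq_bigr => i _; have lt_i := ltn_ord i; rewrite !run1 //; lia.
rewrite !segment1 expr1z add0r.
(* The window at r is exactly [0, n], the whole longer run. *)
have -> : phi (run (n + 1)%N) r%:Z = phi (fun=> x) 0.
  by apply: phi_loc => j j_rt; rewrite run1 //; lia.
rewrite run1; last by lia.
by rewrite -!exprnP => <- /esym/(canRL (addKr _)) ->; ring.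
Qed.

End Conversion.

(** Starting at a nonnegative position avoids negative powers of [beta], so an identity between
    values lifts to Z[X]. *)
Lemma segment_horner (C : numClosedFieldType) (beta : C) (A : {fset C})
    (v : int -> A) (r n : nat) :
  (forall z, z \in A -> exists k : int, z = k%:~R) ->
  exists P : {poly int}, segment beta v r%:Z n = (map_poly intr P).[beta].
Proof.
move=> A_int; elim: n => [|n [P IHn]].
  by exists 0; rewrite rmorph0 horner0 /segment big_ord0.
have [c v_c] := A_int _ (valP (v (r%:Z + n%:Z))).
exists (P + c *: 'X^(r + n)); rewrite -addn1 segmentD IHn segment1 v_c.
by rewrite rmorphD /= map_polyZ map_polyXn hornerD hornerZ hornerXn -exprnP.
Qed.

(* The sign [s] covers at once the cases of a least ([s = 1]) and of a greatest
   ([s = -1]) digit; since the bound does not depend on [l], the hypotheses are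
   contradictory over an archimedean field. *)
Lemma run_length_le_of_extreme_digit (C : numClosedFieldType) (beta : C) (B A : {fset C})
    (r t : nat) (phi : (int -> B) -> int -> A) (x y : B) (s K : C) :
  digit_set_conversion beta phi -> sliding_block r t phi -> 1 < beta ->
  (forall z, z \in A -> 0 <= s * (z - val (phi (fun=> x) 0)) <= K) ->
  s * (val y - val x) <= -1 ->
  forall l : nat, l%:R <= K * \sum_(i < t + r) beta ^ (- t%:Z + i%:Z).
Proof.
move=> phi_dsc phi_loc b_gt1 extreme le_yx l; case: (phi_dsc) => B0 _ _.
have b_ge0 : 0 <= beta by rewrite ltW // (lt_trans ltr01).
pose z := [` B0]%fset; pose k := (r + t)%N; set e := val _ in extreme.
(* The [k] upper letters [x], common to both sequences, keep the upper end of the run out of the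
   windows at positions r to r + l - 1. *)
pose u : int -> B := fun j =>
  if 0 <= j < (l + k)%:Z then if j < l%:Z then y else x else z.
pose u' : int -> B := fun j => if 0 <= j < (l + k)%:Z then x else z.
have u0 j : ~~ (0 <= j < (l + k)%:Z) -> val (u j) = 0 by rewrite /u => /negPf ->.
have u'0 j : ~~ (0 <= j < (l + k)%:Z) -> val (u' j) = 0 by rewrite /u' => /negPf ->.
have eqE : segment beta u 0 (l + k) - segment beta u' 0 (l + k) =
           (val y - val x) * \sum_(i < l) beta ^+ i.
  rewrite !(segmentD _ _ 0 l k) opprD addrACA -[RHS]addr0; congr (_ + _); last first.
    apply/eqP; rewrite subr_eq0; apply/eqP; apply: eq_bigr => i _.
    by rewrite /u /u'; case: ifP => // _; rewrite ifF //; lia.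
  rewrite /segment -sumrB mulr_sumr; apply: eq_bigr => i _.
  have lt_i := ltn_ord i; rewrite add0r -exprnP -mulrBl /u /u'.
  by rewrite !ifT //; lia.
move: eqE; rewrite -(segment_image phi_dsc phi_loc u0) -(segment_image phi_dsc phi_loc u'0).
rewrite (addnA (t + r)%N) !(segmentD _ _ _ (t + r + l) k) opprD addrACA.
rewrite !(segmentD _ _ _ (t + r) l) opprD [X in X + _ = _]addrACA.
have -> : - t%:Z + (t + r)%:Z = r%:Z :> int by lia.
set lo3 := - t%:Z + (t + r + l)%:Z.
(* From r + l on, windows lie above the modified letters. *)
have -> : segment beta (phi u) lo3 k = segment beta (phi u') lo3 k.
  apply: eq_bigr => i _; congr (val _ * _); apply: phi_loc => j j_rt.
  rewrite /u /u' /lo3; case: ifP => // _; rewrite ifF //; lia.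
rewrite subrr addr0 => eqE.
have sR : s * (val y - val x) * \sum_(i < l) beta ^+ i <= - l%:R.
  apply: (@le_trans _ _ (- \sum_(i < l) beta ^+ i)).
    rewrite -[leRHS]mulN1r ler_wpM2r //; apply: sumr_ge0 => i _; exact: exprn_ge0.
  rewrite lerN2 -[X in X%:R <= _](card_ord l) -sumr_const.
  by apply: ler_sum => i _; rewrite exprn_ege1 // ltW.
(* Here [phi u'] shows the extreme digit [e], so no digit of [phi u] lies on its wrong side. *)
have mid_ge0 : 0 <= s * (segment beta (phi u) r%:Z l - segment beta (phi u') r%:Z l).
  rewrite /segment -sumrB mulr_sumr; apply: sumr_ge0 => i _.
  have -> : phi u' (r%:Z + i%:Z) = phi (fun=> x) 0.
    apply: phi_loc => j j_rt; have lt_i := ltn_ord i.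
    by rewrite /u' ifT // /k; lia.
  rewrite -mulrBl mulrA mulr_ge0 ?exprz_ge0 //.
  by case/andP: (extreme _ (valP (phi u (r%:Z + i%:Z)))).
(* The t + r low positions lose at most [K] each, whatever [l] is: compare both digits with [e]. *)
have low_ge : - (K * \sum_(i < t + r) beta ^ (- t%:Z + i%:Z)) <=
    s * (segment beta (phi u) (- t%:Z) (t + r) -
         segment beta (phi u') (- t%:Z) (t + r)).
  rewrite /segment -sumrB !mulr_sumr -sumrN; apply: ler_sum => i _.
  rewrite -mulrBl mulrA -mulNr ler_wpM2r ?exprz_ge0 //.
  case/andP: (extreme _ (valP (phi u (- t%:Z + i%:Z)))) => ge0_u _.
  case/andP: (extreme _ (valP (phi u' (- t%:Z + i%:Z)))) => _ le_u'.
  rewrite -[X in s * (X - _)](subrK e) -addrA mulrDr -[leLHS]add0r.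
  by rewrite lerD // -(opprB _ e) mulrN lerN2.
rewrite -lerN2 (le_trans low_ge) // -[leLHS]addr0 (le_trans _ sR) //.
by rewrite -mulrA -eqE [leRHS]mulrDr lerD2l.
Qed.

(** * Size estimates and the two bounds *)

Lemma contiguous_card (C : numClosedFieldType) (A : {fset C}) (m n : int) :
  m <= n -> (forall k : int, m <= k <= n -> k%:~R \in A) ->
  (`|n - m| < #|` A|)%N.
Proof.
move=> le_mn A_mem; pose s : seq C := [seq (m + i%:Z)%:~R | i <- iota 0 `|n - m|.+1].
suff: (size s <= size (enum_fset A))%N by rewrite size_map size_iota.
apply: uniq_leq_size.
  rewrite map_inj_uniq ?iota_uniq // => i j /intr_inj; lia.
move=> z /mapP [k]; rewrite mem_iota => k_lt ->; apply: A_mem; lia.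
Qed.

Lemma absz_factor_le (k q c : int) : k = q * c -> k != 0 -> (`|c| <= `|k|)%N.
Proof.
by move=> ->; rewrite mulf_eq0 negb_or abszM => /andP[q0 _]; rewrite leq_pmull ?absz_gt0.
Qed.

(** A real element equals its real part, which lies in the archimedean field [R]. *)
Lemma nat_unbounded (R : realType) (x : R[i]) :
  x \is Num.real -> ~ forall l : nat, l%:R <= x.
Proof.
move=> /RRe_real <- bounded; set y := complex.Re x in bounded.
have := bounded (Num.bound `|y|).
rewrite -(rmorph_nat (real_complex R)) lecR leNgt => /negP; apply.
exact: le_lt_trans (ler_norm y) (archi_boundP (normr_ge0 y)).
Qed.

Theorem theorem9 (R : realType) (beta : R[i]) (d : nat) (a : 'I_d -> int)
    (f : {poly int}) (A : {fset R[i]})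
    (beta_gt1 : 1 < `|beta|)
    (beta_int : integralOver (intr : int -> R[i]) beta)
    (f_def : f = 'X^d - \sum_(i < d) a i *: 'X^i)
    (f_min : is_minimal_polynomial (map_poly intr f : {poly rat}) beta)
    (A_int : contiguous_integers A) (A0 : 0 \in A) (A1 : 1 \in A)
    (A_add : parallel_addition beta A) :
  (`|f.[1%R]| <= #|` A|)%N /\
  (beta \is Num.real -> 1 < beta -> (`|f.[1%R]| + 2 <= #|` A|)%N).
Proof.
have b0 : beta != 0 by rewrite -normr_gt0 (lt_trans ltr01).
case: A_int => m [M A_mem]; case: A_add => phi [phi_dsc [p /p_local_sliding_block]].
case=> r [t phi_loc].
have memA (k : int) : (k%:~R \in A) = (m <= k <= M).
  by apply/idP/idP => [/A_mem[j ? /intr_inj ->]//|k_mM]; apply/A_mem; exists k.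
have m_le0 : m <= 0 by have := memA 0; rewrite A0 => /esym/andP[].
have M_ge1 : 1 <= M by have := memA 1; rewrite A1 => /esym/andP[].
have card_A : (`|M - m| < #|` A|)%N.
  by apply: contiguous_card => [|k]; [lia | rewrite memA].
have addA (k l : int) : m <= k <= M -> m <= l <= M ->
    (k + l)%:~R \in alphabet_sum A A.
  by move=> k_mM l_mM; rewrite intrD; apply: in_imfset2; rewrite /= memA.
have f_monic : f \is monic.
  case: f_min => + _ _; rewrite !monicE lead_coef_map_inj //; last exact: intr_inj.
  by rewrite -[1]/(1%:~R) => /eqP/intr_inj ->.
have image_cong (k : int) (kB : k%:~R \in alphabet_sum A A) :
  exists2 g : int, m <= g <= M &
    val (phi (fun=> [` kB]%fset) 0) = g%:~R /\ exists q : int, k - g = q * f.[1].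
  have [|g g_mM gE] := (A_mem (val (phi (fun=> [` kB]%fset) 0))).1; first exact: valP.
  exists g => //; split=> //.
  have [v /=] := constant_image_eq phi_dsc phi_loc [` kB]%fset b0.
  have [z /A_mem[j _ ->]|P ->] := segment_horner beta v r (r + t); first by exists j.
  rewrite gE => eq_beta; case: f_min => _ rf f_min.
  (* [q] lifts the identity [eq_beta]; at X = 1 the multiple of X - 1 dies and k - g remains. *)
  pose q : {poly int} := k *: 'X^(r + t) - (g *: 'X^r + ('X - 1) * P).
  have [|||s q_eq] := @monic_min_dvd _ beta f q f_monic.
  - move=> h h_monic rh; have := f_min h h_monic rh.
    by rewrite size_map_inj_poly //; apply: intr_inj.
  - move: rf; rewrite -map_poly_comp; congr (root _ beta); apply: eq_map_poly => j /=.
    by rewrite ratr_int.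
  - rewrite /root /q !(rmorphB, rmorphD, rmorphM) /= !map_polyZ /= !map_polyXn.
    rewrite map_polyX rmorph1 !(hornerE, hornerXn) eq_beta subrr //.
  exists s.[1]; rewrite -hornerM -q_eq /q !hornerE !expr1n; ring.
split.
  have kB : (M + 1)%:~R \in alphabet_sum A A by apply: addA; lia.
  have [g g_mM [_ [q]]] := image_cong _ kB.
  move=> cong; have : (`|f.[1]%R| <= `|(M + 1 - g)%R|)%N.
    by apply: absz_factor_le cong _; lia.
  by lia.
move=> _ b_gt1.
have MB : M%:~R \in alphabet_sum A A by rewrite -[M]addr0; apply: addA; lia.
have MMB : (M + M)%:~R \in alphabet_sum A A by apply: addA; lia.
have zB : 0%:~R \in alphabet_sum A A by rewrite -[0]addr0; apply: addA; lia.
have [g g_mM [gE [q cong]]] := image_cong _ MB.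
have not_extreme (y : alphabet_sum A A) (s l : int) : val y = l%:~R ->
    (forall j, m <= j <= M -> 0 <= s * (j - g) <= M - m) -> ~ (s * (l - M) <= -1).
  move=> yE extreme le_s.
  have bounded := @run_length_le_of_extreme_digit _ beta _ _ r t phi [` MB]%fset y s%:~R
    (M - m)%:~R phi_dsc phi_loc b_gt1.
  apply: (nat_unbounded _ (bounded _ _)).
  - apply/ger0_real/mulr_ge0; first by rewrite ler0z; lia.
    by apply: sumr_ge0 => i _; rewrite exprz_ge0 // ltW // (lt_trans ltr01).
  - move=> z /A_mem[j /extreme + ->].
    by rewrite gE -rmorphB -rmorphM /= ler0z ler_int.
  - by rewrite yE /= -rmorphB -rmorphM /= -[-1]/((-1)%:~R) ler_int.
have g_neq_m : g <> m.
  (* With [y] = 0 and sign 1, the gap is 0 - M <= -1. *)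
  by move=> g_m; apply: (not_extreme [` zB]%fset 1 0) => // [j|]; rewrite ?g_m; lia.
have g_neq_M : g <> M.
  (* With [y] = 2M and sign -1, the gap is -(2M - M) <= -1. *)
  by move=> g_M; apply: (not_extreme [` MMB]%fset (-1) (M + M)) => // [j|]; rewrite ?g_M; lia.
(* Now m < g < M, so 0 < M - g <= M - m - 1, while #A >= M - m + 1. *)
have : (`|f.[1]%R| <= `|(M - g)%R|)%N by apply: absz_factor_le cong _; lia.
by lia.
Qed.
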